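(* Let $f\colon\mathcal{E}\to\overline{\mathbb{R}}_{++}$ be any upper radial, twice continuously differentiable function with $D(f)<\infty$ and $R(f)>0$. If $f$ is $L$-smooth, then $f^\Gamma$ is $\left(1+\frac{D(f)}{R(f)}\right)^3L$-smooth.
   Context: $\mathcal{E}$ is a finite-dimensional Euclidean space with norm $\|\cdot\|$, and $\overline{\mathbb{R}}_{++}=\mathbb{R}_{++}\cup\{0,+\infty\}$. For $f\colon\mathcal{E}\to\overline{\mathbb{R}}_{++}$: $\mathrm{dom}\,f=\{x: f(x)\in\mathbb{R}_{++}\}$, $\mathrm{epi}\,f=\{(x,u)\in\mathcal{E}\times\mathbb{R}_{++}: f(x)\le u\}$, $\mathrm{hypo}\,f=\{(x,u)\in\mathcal{E}\times\mathbb{R}_{++}: f(x)\ge u\}$. Differentiability of a function into $\overline{\mathbb{R}}_{++}$ is understood at each point of its domain $\mathrm{dom}\,f$: $f$ is twice continuously differentiable if it is so at each $x\in\mathrm{dom}\,f$. A continuously differentiable $f$ is $L$-smooth if $\|\nabla f(x)-\nabla f(x')\|\le L\|x-x'\|$ for all $x,x'\in\mathrm{dom}\,f$. The function $f$ is upper radial if the perspective function $f^p(y,v)=v\cdot f(y/v)$ is upper semicontinuous and nondecreasing in $v\in\mathbb{R}_{++}$. With $\Gamma(x,u)=(x,1)/u$, the radial dual is $f^\Gamma(y)=\sup\{v>0: (y,v)\in\Gamma(\mathrm{epi}\,f)\}=\sup\{v>0: v\cdot f(y/v)\le 1\}$, with $\sup\emptyset=0$. Proximal normals of $S\subseteq\mathcal{E}\times\mathbb{R}$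 at $(x,u)\in S$: $N^P_S((x,u))=\{(\zeta,\delta): (x,u)\text{ is a nearest point of }S\text{ to }(x,u)+\epsilon(\zeta,\delta)\text{ for some }\epsilon>0\}$. $R(f)=\inf\{\|x'\| : (x,u)\in\mathrm{hypo}\,f,\ 0\ne(\zeta,\delta)\in N^P_{\mathrm{hypo}\,f}((x,u)),\ x'\in\mathcal{E},\ (\zeta,\delta)^T((x',0)-(x,u))=0\}$ and $D(f)=\sup\{\|x\|: x\in\mathrm{dom}\,f\}$.
   Formalization: Differentiability of f is taken to include continuity of f on all of E as a map into [0,+∞]; without this the claim fails for functions jumping from +∞, e.g. f=+∞ on |x|≤1/2, 1−|x| on 1/2<|x|<1, 0 elsewhere, whose dual has a kink at |y|=1. *)

(* Defs.v *)
From HB Require Import structures.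
From mathcomp Require Import all_boot all_order all_algebra.
From mathcomp Require Import all_classical all_reals all_analysis.

Set Implicit Arguments.
Unset Strict Implicit.
Unset Printing Implicit Defensive.

Import Order.TTheory GRing.Theory Num.Theory.
Import numFieldNormedType.Exports.

Local Open Scope classical_set_scope.
Local Open Scope ring_scope.

(* [Vector R E] provides the finite dimension; the library norm [`|x|] is the
   one induced by the inner product. *)
HB.mixin Record NormedModule_isEuclidean (R : realType) E
    of NormedModule R E & Vector R E := {
  inner : {dot E for (idfun : R -> R)};
  sqr_norm_inner : forall x : E, `|x| ^+ 2 = inner x x
}.

#[short(type="euclideanType")]
HB.structure Definition Euclidean (R : realType) :=
  {E of NormedModule R E & Vector R E & NormedModule_isEuclidean R E}.

Section RadialDuality.
Context {R : realType} {E : euclideanType R}.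
Implicit Types (f : E -> \bar R) (S : set (E * R)) (p q n : E * R).

(* Functions into [R_{++} U {0, +oo}] are functions [f : E -> \bar R] with
   [0 <= f x] for all [x]. *)

Definition dom f : set E := [set x | (0 < f x < +oo)%E].

Definition epi f : set (E * R) := [set p | 0 < p.2 /\ (f p.1 <= p.2%:E)%E].

Definition hypo f : set (E * R) := [set p | 0 < p.2 /\ (p.2%:E <= f p.1)%E].

(* The library norm of [E * R] is the maximum norm; nearest points and normals
   refer to the Euclidean structure below. *)
Definition inner2 p q : R := inner p.1 q.1 + p.2 * q.2.

Definition norm2 p : R := Num.sqrt (inner2 p p).

Definition nearest_point S q p := S p /\ forall p', S p' -> norm2 (p - q) <= norm2 (p' - q).

Definition proximal_normal S p : set (E * R) :=
  [set n | exists2 e : R, 0 < e & nearest_point S (p + e *: n) p].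

Definition persp f (y : E) (v : R) : \bar R := (v%:E * f (v^-1 *: y)%R)%E.

Definition upper_radial f :=
  (forall (y : E) (v a : R), 0 < v -> (persp f y v < a%:E)%E ->
     \forall p \near (y, v), (persp f p.1 p.2 < a%:E)%E) /\
  (forall (y : E) (v w : R), 0 < v -> v <= w ->
     (persp f y v <= persp f y w)%E).

Definition Gamma p : E * R := (p.2^-1 *: p.1, p.2^-1).

(* The maximum with 0 implements [sup set0 = 0]. *)
Definition radial_dual f (y : E) : \bar R :=
  maxe 0%E (ereal_sup [set v%:E | v in [set v : R | 0 < v /\ (Gamma @` epi f) (y, v)]]).

(* The Riesz representative of the differential of the real-valued function
   [fine \o f]. *)
Definition grad f (x : E) : E :=
  xget 0 [set g | forall h : E, 'd (fine \o f) x h = inner g h].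

(* Derivatives are taken at the points of [dom f] only.  There they are the
   usual ones: if [fine \o f] is continuous at a point of [dom f], then it is
   positive, and hence [f] is finite, in a neighbourhood of this point.
   In addition, as a differentiable function into [R_{++} U {0, +oo}], [f] is
   required to be continuous on the whole of [E], for the topology of [\bar R].
   This excludes a jump from +oo to a finite value at the boundary of [dom f],
   which derivatives on [dom f] alone do not see: on the real line, the function
   equal to +oo for |x| <= 1/2, to 1 - |x| for 1/2 < |x| < 1 and to 0 elsewhere
   is smooth on its domain, but its radial dual is 2|y| for |y| <= 1 and
   1 + |y| for |y| > 1, which has a kink at |y| = 1. *)
Definition cont_diff f :=
  continuous f /\
  (forall x, dom f x ->
     differentiable (fine \o f) x /\ {for x, continuous (grad f)}).

(* The last condition is the continuity at [x] of the second differential for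
   the operator norm. *)
Definition cont_diff2 f :=
  cont_diff f /\
  (forall x, dom f x ->
     differentiable (grad f) x /\
     (forall e : R, 0 < e -> \forall y \near x, forall h : E,
        `|'d (grad f) y h - 'd (grad f) x h| <= e * `|h|)).

Definition smooth (L : R) f :=
  cont_diff f /\
  (forall x x', dom f x -> dom f x' ->
     `|grad f x - grad f x'| <= L * `|x - x'|).

(* The distance from the origin to the points of [E] at height 0 on hyperplanes
   normal to [hypo f]; +oo if there are none. *)
Definition tangent_dist f : \bar R :=
  ereal_inf [set `|x'|%:E | x' in [set x' : E | exists p n,
    [/\ hypo f p, n != 0, proximal_normal (hypo f) p n &
        inner2 n ((x', 0) - p) = 0]]].

(* If [dom f] is empty, this is -oo. *)
Definition dom_radius f : \bar R := ereal_sup [set `|x|%:E | x in dom f].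

End RadialDuality.

(* Main.v *)
(** Write [p = grad f] and [a x = f x - <p x, x>], the height over the origin of
    the tangent plane of [f] at [x].  Upper radiality gives [a >= 0], and since
    [(- p x, 1)] is a proximal normal of [hypo f] at [(x, f x)], the definition
    of [R(f)] sharpens this to [R(f) |p x| <= a x]; hence
    [|x| |p x| <= k (a x)] with [k = D(f) / R(f)].

    If [dom f] is empty, [f] and its dual are constant.  Otherwise [f] is
    finite, [f 0 > 0], and the dual value [v] at [y] is the root of
    [v f (y / v) = 1], which is nondegenerate because the left-hand side has
    derivative [a (y / v) > 0] in [v].  So the dual is positive, finite and
    differentiable on the whole space, with gradient [- p x / a x] at [y],
    where [x = y / v].

    With [q = p / a] one has the exact identity
    [a x (q x' - q x) = p x' - p x + (a x - a x') q x'], where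
    [a x - a x' = <p x' - p x, x'> + o(|x' - x|)], so that
    [a x |q x' - q x| <= (1 + k) L |x' - x|] up to first order.  In the same way
    [|x' - x| <= f x (1 + k) |y' - y|], and [f x <= (1 + k) a x].  This bounds
    the local Lipschitz constant of the dual gradient by [(1 + k)^3 L], and
    local bounds integrate along segments. *)
Require Import Defs.
From HB Require Import structures.
From mathcomp Require Import all_boot all_order all_algebra.
From mathcomp Require Import all_classical all_reals all_analysis.
From mathcomp Require Import ring lra.

Import Order.TTheory GRing.Theory Num.Theory.
Import numFieldNormedType.Exports.

Local Open Scope classical_set_scope.
Local Open Scope ring_scope.

Section InnerProduct.
Context {R : realType} {E : euclideanType R}.
Implicit Types (x y z : E) (c : R).

Lemma innerC x y : inner x y = inner y x.
Proof. by rewrite hermC /= expr0 mul1r. Qed.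

Lemma innerDr x y z : inner x (y + z) = inner x y + inner x z.
Proof. exact: linearDr. Qed.

Lemma innerBr x y z : inner x (y - z) = inner x y - inner x z.
Proof. exact: linearBr. Qed.

Lemma innerNr x y : inner x (- y) = - inner x y.
Proof. exact: linearNr. Qed.

Lemma innerZr c x y : inner x (c *: y) = c * inner x y.
Proof. exact: linearZr_LR. Qed.

Lemma inner0r x : inner x 0 = 0.
Proof. exact: linear0r. Qed.

Lemma innerDl x y z : inner (y + z) x = inner y x + inner z x.
Proof. by rewrite ![inner _ x]innerC innerDr. Qed.

Lemma innerBl x y z : inner (y - z) x = inner y x - inner z x.
Proof. by rewrite ![inner _ x]innerC innerBr. Qed.

Lemma innerNl x y : inner (- y) x = - inner y x.
Proof. by rewrite ![inner _ x]innerC innerNr. Qed.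

Lemma innerZl c x y : inner (c *: y) x = c * inner y x.
Proof. by rewrite ![inner _ x]innerC innerZr. Qed.

Lemma inner0l x : inner 0 x = 0.
Proof. by rewrite innerC inner0r. Qed.

Lemma cauchy_schwarz x y : `|inner x y| <= `|x| * `|y|.
Proof.
have [->|y0] := eqVneq y 0; first by rewrite inner0r !normr0 mulr0.
have y2 : 0 < inner y y by rewrite -sqr_norm_inner exprn_gt0 // normr_gt0.
have : 0 <= `|inner y y *: x - inner x y *: y| ^+ 2 by rewrite sqr_ge0.
rewrite sqr_norm_inner !(innerBr, innerBl, innerZr, innerZl) (innerC y x).
rewrite -(ler_sqr (x := `|inner x y|)) ?nnegrE ?mulr_ge0 //.
rewrite real_normK ?num_real // exprMn !sqr_norm_inner.
move: y2; move: (inner y y) (inner x x) (inner x y) => b a k b0 h.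
have : 0 <= b * (a * b - k ^+ 2) by lra.
by rewrite pmulr_rge0 // subr_ge0.
Qed.

Lemma inner_ge x y : - (`|x| * `|y|) <= inner x y.
Proof. by have := cauchy_schwarz x y; rewrite ler_norml => /andP[]. Qed.

Lemma inner_le x y : inner x y <= `|x| * `|y|.
Proof. by have := cauchy_schwarz x y; rewrite ler_norml => /andP[]. Qed.

Lemma inner_eqP x y : (forall z, inner x z = inner y z) -> x = y.
Proof.
move=> h; apply/eqP; rewrite -subr_eq0 -normr_eq0 -sqrf_eq0 sqr_norm_inner.
by rewrite {1}innerBl h subrr.
Qed.

Lemma sqr_normDZ x y c : inner (x + c *: y) (x + c *: y) =
  `|x| ^+ 2 + 2 * c * inner y x + inner (c *: y) (c *: y).
Proof.
rewrite sqr_norm_inner innerDr !innerDl [inner x (_ *: _)]innerC innerZl.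
by ring.
Qed.

Lemma riesz (l : {linear E -> R}) : exists g, forall h, l h = inner g h.
Proof.
pose phi (g : E) : 'Hom(E, R^o) := linfun (inner g : E -> R^o).
have phiE g h : phi g h = inner g h by rewrite lfunE.
have lphi : linear phi.
  move=> a u v; apply/lfunP => h.
  by rewrite phiE add_lfunE scale_lfunE !phiE linearPl.
pose Phi : 'Hom(E, 'Hom(E, R^o)) := linfun
  (HB.pack phi (GRing.isLinear.Build _ _ _ _ phi lphi)
    : {linear E -> 'Hom(E, R^o)}).
have PhiE g : Phi g = phi g by rewrite lfunE.
have ker0 : lker Phi == 0%VS.
  apply/lker0P => u v; rewrite !PhiE => uv; apply: inner_eqP => z.
  by rewrite -!phiE uv.
have : (limg Phi == fullv)%VS.
  rewrite eqEdim subvf /= (limg_dim_eq _) ?(eqP ker0) ?capv0 //.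
  by rewrite !dimvf; apply/eq_leq/muln1.
move=> /eqP full.
have : linfun (l : E -> R^o) \in limg Phi by rewrite full memvf.
move=> /memv_imgP[g _ gl]; exists g => h.
by rewrite -phiE -PhiE -gl lfunE.
Qed.

End InnerProduct.

Section Lipschitz.
Context {R : realType}.

Lemma lipschitz_itv (V : normedModType R) (g : R -> V) (a b K : R) : a <= b ->
  (forall t, a <= t <= b -> forall e, 0 < e ->
    \forall s \near t, `|g s - g t| <= (K + e) * `|s - t|) ->
  `|g b - g a| <= K * (b - a).
Proof.
move=> ab loc; have [->|neq] := eqVneq a b.
  by rewrite !subrr normr0 mulr0.
have ba : 0 < b - a by rewrite subr_gt0 lt_neqAle neq.
rewrite -ler_pdivrMr //; apply/ler_addgt0Pr => e e0; rewrite ler_pdivrMr //.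
set c := K + e.
pose A := [set t : R | a <= t <= b /\ `|g t - g a| <= c * (t - a)].
have Aa : A a by split; rewrite ?lexx ?ab // !subrr normr0 mulr0.
have Aub : ubound A b by move=> t [/andP[]].
have supA : has_sup A by split; [exists a | exists b].
set s := sup A.
have as_ : a <= s by apply: ub_le_sup => //; exists b.
have sb : s <= b by apply: ge_sup => //; exists a.
have /nbhs_ballP[d /= d0 dP] := loc s (introT andP (conj as_ sb)) e e0.
have sP t : `|t - s| < d -> `|g t - g s| <= c * `|t - s|.
  by move=> tsd; apply: dP; rewrite /ball /= distrC.
have As : A s.
  split; first by rewrite as_.
  have [t At st] := sup_adherent d0 supA.
  have ts : t <= s by apply: ub_le_sup => //; exists b.
  have [_ gt] := At.
  have := sP t; rewrite ler0_norm ?subr_le0 // opprB => /(_ _)/[dup] h1.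
  have {}h1 : `|g t - g s| <= c * (s - t) by apply: h1; rewrite ltrBlDr -ltrBlDl.
  move=> _; rewrite -[g s - g a](subrKA (g t)).
  apply: le_trans (ler_normD _ _) _; rewrite distrC.
  by apply: le_trans (lerD h1 gt) _; rewrite -mulrDr subrKA.
have [-> |sb'] := eqVneq b s; first by case: As.
have {sb' }sb' : s < b by rewrite lt_neqAle eq_sym sb'.
pose t := Num.min b (s + d / 2).
have st : s < t by rewrite lt_min sb' ltrDl divr_gt0.
suff At : A t.
  have : t <= s by apply: ub_le_sup => //; exists b.
  by rewrite leNgt st.
split; first by rewrite (le_trans as_ (ltW st)) ge_min lexx.
have := sP t; rewrite gtr0_norm ?subr_gt0 // => h1.
have {}h1 : `|g t - g s| <= c * (t - s).
  apply: h1; rewrite ltrBlDl gt_min; apply/orP; right.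
  by rewrite ltrD2l ltr_pdivrMr // mulr_natr mulr2n ltrDl.
rewrite -[g t - g a](subrKA (g s)).
apply: le_trans (ler_normD _ _) _.
by apply: le_trans (lerD h1 As.2) _; rewrite -mulrDr subrKA.
Qed.

Lemma lipschitz_along (U V : normedModType R) (g : U -> V) (K : R) (x y : U) :
  (forall t, 0 <= t <= 1 -> forall e, 0 < e ->
    \forall z \near x + t *: (y - x),
      `|g z - g (x + t *: (y - x))| <= (K + e) * `|z - (x + t *: (y - x))|) ->
  `|g y - g x| <= K * `|y - x|.
Proof.
move=> loc; have [->|neq] := eqVneq y x.
  by rewrite !subrr !normr0 mulr0.
have d0 : 0 < `|y - x| by rewrite normr_gt0 subr_eq0.
pose s t := x + t *: (y - x).
have := @lipschitz_itv V (g \o s) 0 1 (K * `|y - x|) ler01.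
rewrite subr0 mulr1 /= /s scale1r scale0r addr0 [x + _]addrC subrK; apply.
move=> t t01 e e0.
have cs : s @ t --> s t.
  by apply: cvgD; [exact: cvg_cst | apply: cvgZr_tmp; exact: cvg_id].
have := cs _ (loc t t01 _ (divr_gt0 e0 d0)); apply: (@filterS _ (nbhs t)) => r.
move=> /= /le_trans; apply.
rewrite /s opprD addrACA subrr add0r -scalerBl normrZ.
by rewrite le_eqVlt; apply/orP; left; apply/eqP; field; rewrite gt_eqF.
Qed.

Lemma lipschitz_of_local (U V : normedModType R) (g : U -> V) (K : R) :
  (forall x e, 0 < e ->
    \forall z \near x, `|g z - g x| <= (K + e) * `|z - x|) ->
  forall x y, `|g y - g x| <= K * `|y - x|.
Proof. by move=> loc x y; apply: lipschitz_along => t _; exact: loc. Qed.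

End Lipschitz.


Section Expansion.
Set Implicit Arguments.
Unset Strict Implicit.
Context {R : realType} {E : euclideanType R}.

Lemma continuous_inner (v : E) : continuous (inner v : E -> R).
Proof.
apply/(linear_bounded_continuous (inner v : {linear E -> R})).
apply/linear_boundedP; exists `|v|; split; first exact: normr_real.
by move=> M vM x; apply: le_trans (cauchy_schwarz v x) _; rewrite ler_wpM2r // ltW.
Qed.

Lemma is_diff_innerP (g : E -> R) (x v : E) :
  is_diff x g (inner v) <->
  forall e, 0 < e ->
    \forall z \near x, `|g z - g x - inner v (z - x)| <= e * `|z - x|.
Proof.
have expP : (g \o shift x = cst (g x) + inner v +o_ 0 id) <->
    forall e, 0 < e ->
    \forall z \near x, `|g z - g x - inner v (z - x)| <= e * `|z - x|.
  rewrite eqaddoP; split=> + e e0 => /(_ e e0).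
    rewrite [in X in _ -> X](near_shift 0) subr0.
    apply: filterS => h /=.
    by rewrite addrK !fctE /= opprD addrA.
  rewrite [in X in X -> _](near_shift 0) subr0.
  apply: filterS => h /=.
  by rewrite addrK !fctE /= opprD addrA.
split=> [[dg dgv]|gv].
  by apply/expP; rewrite -dgv; apply: diff_locally.
have dgv : 'd g x = inner v :> (E -> R).
  by apply: diff_unique; [exact: continuous_inner|apply/expP].
split => //; apply/diff_locallyP; rewrite dgv; split; last exact/expP.
exact: continuous_inner.
Qed.

Lemma is_diff_grad (f : E -> \bar R) x : differentiable (fine \o f) x ->
  is_diff x (fine \o f) (inner (grad f x)).
Proof.
move=> df; split => //; apply/funext.
exact: (xgetPex 0 (riesz ('d (fine \o f) x))).
Qed.

Lemma grad_unique (f : E -> \bar R) x v : is_diff x (fine \o f) (inner v) ->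
  grad f x = v.
Proof.
move=> [df dfv]; apply: inner_eqP => z.
by have [_ <-] := is_diff_grad df; rewrite dfv.
Qed.

End Expansion.

Section FiniteOrInfty.
Set Implicit Arguments.
Unset Strict Implicit.
Context {R : realType} {E : euclideanType R} (f : E -> \bar R) (M : R).
Hypothesis f_ge0 : forall x, (0 <= f x)%E.
Hypothesis fC : continuous f.
Hypothesis fD : forall x, dom f x -> differentiable (fine \o f) x.
Hypothesis M_ge0 : 0 <= M.
Hypothesis fM : forall x, dom f x -> `|grad f x| <= M.

Lemma near_lt x b : (f x < b)%E -> \forall z \near x, (f z < b)%E.
Proof. by move=> /open_ereal_lt'; apply: fC. Qed.

Lemma near_gt x b : (b < f x)%E -> \forall z \near x, (b < f z)%E.
Proof. by move=> /open_ereal_gt'; apply: fC. Qed.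

Lemma dom_nbhs x : dom f x -> \forall z \near x, dom f z.
Proof.
move=> /andP[f0 foo]; near=> z; apply/andP; split.
  by near: z; exact: near_gt.
by near: z; exact: near_lt.
Unshelve. all: by end_near. Qed.

Lemma domE x : dom f x -> f x = ((fine \o f) x)%:E.
Proof. by move=> /andP[f0 foo]; rewrite fineK // fin_numE gt_eqF ?lt_eqF //
  (lt_trans _ f0). Qed.

(* Truncating at [c] and [C] makes [f] locally constant near the points where it
   is 0 or +oo, so the bound on the gradient on [dom f] becomes a global Lipschitz
   bound that does not depend on [C]. *)
Let clamp (c C : R) (r : \bar R) := fine (mine (maxe r c%:E) C%:E).

Lemma clamp_lipschitz (c C : R) : 0 < c -> c <= C -> forall x y,
  `|clamp c C (f y) - clamp c C (f x)| <= M * `|y - x|.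
Proof.
move=> c0 cC; apply: lipschitz_of_local => x e e0.
have K0 : 0 <= M + e by rewrite addr_ge0 // ltW.
have clampc r : (r < c%:E)%E -> clamp c C r = c.
  move=> rc; rewrite /clamp (max_idPr _) ?ltW // (min_idPl _) //=.
have clampC r : (C%:E < r)%E -> clamp c C r = C.
  move=> Cr; rewrite /clamp (min_idPr _) //= le_max (ltW Cr) //.
have [dx|ndx] := pselect (dom f x).
  have /is_diff_innerP/(_ e e0) := is_diff_grad (fD dx).
  apply: filterS2 (dom_nbhs dx) => z dz exz.
  rewrite (domE dx) (domE dz) /clamp -!EFin_max -!EFin_min /=.
  have : `|fine (f z) - fine (f x)| <= (M + e) * `|z - x|.
    rewrite -[_ - _](subrK (inner (grad f x) (z - x))).
    apply: le_trans (ler_normD _ _) _; rewrite addrC mulrDl lerD //.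
    by apply: le_trans (cauchy_schwarz _ _) _; rewrite ler_wpM2r // fM.
  apply: le_trans; move: (fine _) (fine _) => a b.
  have maxL : `|Num.max a c - Num.max b c| <= `|a - b|.
    by rewrite ler_norml; case: (ger0P (a - b)) => ?; case: (leP a c) => ?;
      case: (leP b c) => ?; apply/andP; split; lra.
  rewrite distrC [leRHS]distrC; apply: le_trans maxL.
  move: (Num.max a c) (Num.max b c) => {}a {}b.
  by rewrite ler_norml; case: (ger0P (a - b)) => ?; case: (leP a C) => ?;
    case: (leP b C) => ?; apply/andP; split; lra.
have [fx0|fx0] := eqVneq (f x) 0%E.
  have fxc : (f x < c%:E)%E by rewrite fx0 lte_fin.
  apply: filterS (near_lt fxc) => z fzc.
  by rewrite !clampc // subrr normr0 mulr_ge0.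
have fxC : (C%:E < f x)%E.
  have f0 : (0 < f x)%E by rewrite lt_neqAle eq_sym fx0 f_ge0.
  suff -> : f x = +oo%E by rewrite ltry.
  apply/eqP; apply: contra_notT ndx => foo; apply/andP; split => //.
  by rewrite lt_neqAle foo leey.
apply: filterS (near_gt fxC) => z fzC.
by rewrite !clampC // subrr normr0 mulr_ge0.
Qed.

Lemma finite_or_infty x y : f x = +oo%E -> f y = +oo%E.
Proof.
move=> fx; apply/eqP; apply/negPn/negP => fy.
have {fy}fy : f y = (fine (f y))%:E.
  rewrite fineK // fin_numE fy andbT gt_eqF //; exact: lt_le_trans (f_ge0 y).
have y0 : 0 <= fine (f y) by rewrite fine_ge0.
set c := fine (f y) + 1; set C := c + (M * `|y - x| + 1).
have xy0 : 0 <= M * `|y - x| by rewrite mulr_ge0.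
have c0 : 0 < c by rewrite /c; lra.
have cC : c <= C by rewrite /C; lra.
have := clamp_lipschitz c0 cC x y.
rewrite /clamp fx fy maxye minye /= -EFin_max -EFin_min /=.
have -> : Num.max (fine (f y)) c = c by apply/max_idPr; rewrite lerDl.
rewrite (min_idPl cC) distrC.
have -> : C - c = M * `|y - x| + 1 by rewrite /C; lra.
by rewrite ger0_norm; lra.
Qed.

End FiniteOrInfty.

Section Intercept.
Set Implicit Arguments.
Unset Strict Implicit.
Context {R : realType} {E : euclideanType R}.
Variables (phi : E -> R) (p : E -> E) (L r : R).
Let f (x : E) := (phi x)%:E.
Hypothesis phiC : continuous phi.
Hypothesis phi_radial : forall y v w, 0 < v -> v <= w ->
  v * phi (v^-1 *: y) <= w * phi (w^-1 *: y).
Hypothesis phiD : forall x, 0 < phi x -> is_diff x phi (inner (p x)).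
Hypothesis pL : forall x y, 0 < phi x -> 0 < phi y ->
  `|p x - p y| <= L * `|x - y|.
Hypothesis r_gt0 : 0 < r.
Hypothesis r_le : (r%:E <= tangent_dist f)%E.

Let a x := phi x - inner (p x) x.

Lemma phi_ray x t : 0 < t -> t <= 1 -> t * phi x <= phi (t *: x).
Proof.
move=> t0 t1; have := @phi_radial x 1 t^-1 ltr01.
rewrite invr1 scale1r mul1r invrK invf_ge1 // => /(_ t1).
by rewrite -(ler_pM2l t0) mulrA divff ?mul1r ?gt_eqF.
Qed.

Lemma cvg_ray (x : E) (t : R) : s *: x @[s --> t] --> t *: x.
Proof. exact: (cvgZr_tmp cvg_id). Qed.

Lemma intercept_ge0 x : 0 < phi x -> 0 <= a x.
Proof.
move=> dx; apply/ler_addgt0Pr => e e0.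
have e'0 : 0 < e / (`|x| + 1) by rewrite divr_gt0 // ltr_wpDl.
have /is_diff_innerP/(_ _ e'0) := phiD dx.
move=> h; have := @cvg_ray x 1; rewrite scale1r => /(_ _ h).
move=> /nbhs_ballP[d /= d0 dP] {h}.
pose t := Num.max (1 - d / 2) (1 / 2).
have t1 : t < 1 by rewrite gt_max; apply/andP; split; lra.
have t0 : 0 < t by rewrite lt_max; apply/orP; right; lra.
have /dP /= : ball (1 : R) d t.
  rewrite /ball /= ger0_norm ?subr_ge0 ?(ltW t1) // ltrBlDl -ltrBlDr.
  by rewrite lt_max; apply/orP; left; lra.
have -> : t *: x - x = - (1 - t) *: x by rewrite opprB scalerBl scale1r.
move=> /(le_trans (ler_norm _)).
rewrite innerZr normrZ normrN ger0_norm ?subr_ge0 ?(ltW t1) // mulrCA mulNr opprK.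
have := phi_ray x t0 (ltW t1).
have ex : e / (`|x| + 1) * `|x| <= e.
  by rewrite mulrAC ler_pdivrMr ?ltr_wpDl // ler_pM2l // lerDl.
rewrite /a; move: (inner _ _) => k; move: (e / _ * _) ex => e' ex h1 h2.
have : 0 <= (1 - t) * (phi x - k + e') by lra.
by rewrite pmulr_rge0 ?subr_gt0 //; lra.
Qed.

Lemma phi_descent x d : 0 < d -> (forall z, `|z - x| < d -> 0 < phi z) ->
  forall z, `|z - x| < d ->
  `|phi z - phi x - inner (p x) (z - x)| <= `|L| * `|z - x| ^+ 2.
Proof.
move=> d0 dP z zd.
pose g z := phi z - inner (p x) z.
have gB u v : g u - g v = phi u - phi v - inner (p x) (u - v).
  by rewrite /g innerBr; ring.
rewrite -gB expr2 mulrA; apply: lipschitz_along => t /andP[t0 t1] e e0.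
set w := x + t *: (z - x).
have wx : `|w - x| <= `|z - x|.
  by rewrite /w addrAC subrr add0r normrZ ger0_norm // ler_piMl.
have dw : 0 < phi w by apply: dP; exact: le_lt_trans zd.
have dx : 0 < phi x by apply: dP; rewrite subrr normr0.
have /is_diff_innerP/(_ e e0) := phiD dw.
apply: filterS => u hu; rewrite gB.
have -> : phi u - phi w - inner (p x) (u - w) =
    inner (p w - p x) (u - w) + (phi u - phi w - inner (p w) (u - w)).
  by rewrite innerBl; ring.
apply: le_trans (ler_normD _ _) _; rewrite mulrDl lerD //.
apply: le_trans (cauchy_schwarz _ _) _; rewrite ler_wpM2r //.
apply: le_trans (pL dw dx) _; apply: le_trans (ler_norm _) _.
by rewrite normrM normr_id ler_wpM2l.
Qed.

Lemma phi_ball x : 0 < phi x ->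
  exists2 d, 0 < d & forall z, `|z - x| < d -> 0 < phi z.
Proof.
move=> dx; have : \forall z \near x, 0 < phi z by exact: (cvgr_gt _ (@phiC x)).
move=> /nbhs_ballP[d /= d0 dP].
by exists d => // z zd; apply: dP; rewrite -ball_normE /= distrC.
Qed.

Lemma graph_normal x : 0 < phi x ->
  proximal_normal (hypo f) (x, phi x) (- p x, 1).
Proof.
move=> dx; have [d d0 dP] := phi_ball dx.
set P := `|p x|.
have P0 : 0 <= P by exact: normr_ge0.
pose e := Num.min (1 / (2 * (`|L| + 1))) (d / (2 * (1 + P))).
have L0 : 0 < 2 * (`|L| + 1) by rewrite mulr_gt0 // ltr_wpDl.
have P1 : 0 < 2 * (1 + P) by rewrite mulr_gt0 // ltr_wpDr.
have e0 : 0 < e by rewrite lt_min !divr_gt0.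
have eL : 2 * e * `|L| <= 1.
  have : e <= 1 / (2 * (`|L| + 1)) by rewrite ge_min lexx.
  by rewrite ler_pdivlMr //; lra.
have eP : e * (2 * (1 + P)) <= d.
  by rewrite -ler_pdivlMr // ge_min lexx orbT.
exists e => //; split; first by rewrite /hypo /f /= dx lexx.
move=> [z u] /= [u0]; rewrite lee_fin => uz.
have {}uz : u <= phi z by [].
apply: ler_wsqrtr; rewrite /inner2 /= ![e *: 1](mulr1 e).
pose h := z - x; pose s := u - phi x.
have -> : x - (x + e *: - p x) = e *: p x by rewrite scalerN opprB addrC subrK.
have -> : z - (x + e *: - p x) = h + e *: p x by rewrite scalerN opprB addrCA addrC.
have -> : phi x - (phi x + e) = - e by ring.
have -> : u - (phi x + e) = s - e by rewrite /s; ring.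
rewrite (sqr_normDZ h (p x)).
suff : 2 * e * (s - inner (p x) h) <= `|h| ^+ 2 + s ^+ 2 by lra.
have [hd|hd] := ltP `|h| d.
  have := phi_descent d0 dP hd; rewrite -/h => /(le_trans (ler_norm _)) h1.
  have h2 : s - inner (p x) h <= `|L| * `|h| ^+ 2 by rewrite /s; lra.
  apply: le_trans (ler_wpM2l _ h2) _; first by rewrite mulr_ge0 // ltW.
  rewrite mulrA; apply: le_trans (ler_wpM2r _ eL) _; rewrite ?sqr_ge0 //.
  by rewrite mul1r lerDl sqr_ge0.
have := inner_ge (p x) h; rewrite -/P; move: (inner _ _) => k hk.
have hh : d ^+ 2 <= `|h| ^+ 2 by rewrite ler_sqr ?nnegrE ?normr_ge0 // ltW.
have ee : (e * (2 * (1 + P))) ^+ 2 <= d ^+ 2.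
  by rewrite ler_sqr ?nnegrE // ltW // mulr_gt0.
have h1 : 0 <= (s - e) ^+ 2 by rewrite sqr_ge0.
have h2 : 0 <= (`|h| - 2 * e * P) ^+ 2 by rewrite sqr_ge0.
have h3 : 0 <= e ^+ 2 * P by rewrite mulr_ge0 // sqr_ge0.
have h4 : - (e * (P * `|h|)) <= e * k by rewrite -mulrN ler_pM2l.
move: h1 h2 h3 h4 ee hh; move: `|h| => H; nra.
Qed.

Lemma grad_le_intercept x : 0 < phi x -> r * `|p x| <= a x.
Proof.
move=> dx; have := intercept_ge0 dx.
have [->|px0] := eqVneq (p x) 0; first by rewrite normr0 mulr0.
have P0 : 0 < `|p x| by rewrite normr_gt0.
move=> a0; rewrite -ler_pdivlMr // -lee_fin; apply: le_trans r_le _.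
apply: ereal_inf_lbound; exists (- (a x / `|p x| ^+ 2) *: p x); last first.
  rewrite normrZ normrN ger0_norm ?divr_ge0 ?sqr_ge0 //.
  by congr (_ %:E); field; rewrite gt_eqF.
exists (x, phi x), (- p x, 1); split.
- by rewrite /hypo /f /= dx lexx.
- by apply/eqP => -[_ /eqP]; rewrite oner_eq0.
- exact: graph_normal.
rewrite /inner2 /= innerNl innerBr innerZr -sqr_norm_inner mulNr divfK.
  by rewrite /a; ring.
by rewrite gt_eqF ?exprn_gt0.
Qed.

Lemma intercept_gt0 x : 0 < phi x -> 0 < a x.
Proof.
move=> dx; have := grad_le_intercept dx.
have [p0|px0] := eqVneq (p x) 0; first by rewrite /a p0 inner0l subr0.
by apply: lt_le_trans; rewrite mulr_gt0 ?normr_gt0.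
Qed.

(* If [phi 0 = 0], then [phi] is at least linear on the segment from 0 to [x],
   while [r * |p| <= a] forces the gradient to vanish along it near 0. *)
Lemma phi0_gt0 x : 0 < phi x -> 0 < phi 0.
Proof.
move=> dx; rewrite ltNge; apply/negP => phi0.
have ray0 : phi (t *: x) @[t --> 0] --> phi 0.
  rewrite -[in X in _ --> X](scale0r x).
  by apply: (cvg_comp _ _ (@cvg_ray x 0)); exact: phiC.
have x0 : 0 < `|x|.
  by rewrite normr_gt0; apply: contraTneq dx => ->; rewrite -leNgt.
set m := phi x; pose e := m / (2 * `|x|).
have e0 : 0 < e by rewrite divr_gt0 // mulr_gt0.
have small b : 0 < b -> \forall t \near (0 : R), phi (t *: x) < b.
  by move=> b0; apply: (cvgr_lt _ ray0); exact: le_lt_trans b0.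
have /nbhs_ballP[d1 /= d10 d1P] := small _ (mulr_gt0 e0 (divr_gt0 r_gt0 (ltr0n _ 2))).
pose d := Num.min (Num.min (d1 / 2) 1) (r / 2 / `|x|).
have d0 : 0 < d by rewrite !lt_min ltr01 !divr_gt0.
have dd1 : d < d1 by rewrite /d !gt_min; apply/orP; left; apply/orP; left; lra.
have d_1 : d <= 1 by rewrite /d !ge_min lexx orbT.
have dr : d * `|x| <= r / 2 by rewrite -ler_pdivlMr // ge_min lexx orbT.
have ray t : 0 < t -> t <= d -> 0 < phi (t *: x).
  move=> t0 td; apply: lt_le_trans (phi_ray x t0 (le_trans td d_1)).
  exact: mulr_gt0.
have pe t : 0 < t -> t <= d -> `|p (t *: x)| <= e.
  move=> t0 td; have := grad_le_intercept (ray t t0 td); rewrite /a.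
  have := inner_ge (p (t *: x)) (t *: x); rewrite normrZ gtr0_norm //.
  have : phi (t *: x) < e * (r / 2).
    by apply: d1P; rewrite /ball /= sub0r normrN gtr0_norm // (le_lt_trans td).
  move: `|p _| (normr_ge0 (p (t *: x))) => P P0 h1 h2 h3.
  have h4 : P * (t * `|x|) <= P * (r / 2).
    by rewrite ler_wpM2l // (le_trans _ dr) // ler_wpM2r.
  have : P * (r / 2) <= e * (r / 2) by lra.
  by rewrite ler_pM2r // divr_gt0.
have lip s : 0 < s -> s <= d -> phi (d *: x) - phi (s *: x) <= e * ((d - s) * `|x|).
  move=> s0 sd; apply: le_trans (ler_norm _) _.
  have -> : (d - s) * `|x| = `|d *: x - s *: x|.
    by rewrite -scalerBl normrZ ger0_norm // subr_ge0.
  apply: lipschitz_along => t /andP[t0 t1] e' e'0.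
  have -> : s *: x + t *: (d *: x - s *: x) = (s + t * (d - s)) *: x.
    by rewrite -scalerBl scalerA -scalerDl.
  have ds : 0 <= t * (d - s) by rewrite mulr_ge0 // subr_ge0.
  have ds' : t * (d - s) <= d - s by rewrite ler_piMl // subr_ge0.
  set q := s + _; have q0 : 0 < q by rewrite /q; lra.
  have qd : q <= d by rewrite /q; lra.
  have /is_diff_innerP/(_ e' e'0) := phiD (ray q q0 qd).
  apply: filterS => z hz.
  rewrite -[_ - _](subrK (inner (p (q *: x)) (z - q *: x))).
  apply: le_trans (ler_normD _ _) _; rewrite addrC mulrDl lerD //.
  by apply: le_trans (cauchy_schwarz _ _) _; rewrite ler_wpM2r // pe.
have dm : 0 < d * m / 2 by rewrite divr_gt0 // mulr_gt0.
have /nbhs_ballP[d2 /= d20 d2P] := small _ dm.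
pose s := Num.min d (d2 / 2).
have s0 : 0 < s by rewrite lt_min d0 divr_gt0.
have sd : s <= d by rewrite ge_min lexx.
have hs : phi (s *: x) < d * m / 2.
  apply: d2P; rewrite /ball /= sub0r normrN gtr0_norm // gt_min.
  by apply/orP; right; lra.
have := lip s s0 sd; have := phi_ray x d0 d_1; rewrite -/m.
have : e * ((d - s) * `|x|) <= d * m / 2.
  have -> : e * ((d - s) * `|x|) = (d - s) * m / 2.
    by rewrite /e; field; rewrite gt_eqF.
  by rewrite ler_pM2r // ler_pM2r // gerBl ltW.
by lra.
Qed.

End Intercept.

Section Dual.
Set Implicit Arguments.
Unset Strict Implicit.
Context {R : realType} {E : euclideanType R}.
Variables (phi : E -> R) (p : E -> E) (L r k D : R).
Let f (x : E) := (phi x)%:E.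
Let a x := phi x - inner (p x) x.
Hypothesis phiC : continuous phi.
Hypothesis phi_radial : forall y v w, 0 < v -> v <= w ->
  v * phi (v^-1 *: y) <= w * phi (w^-1 *: y).
Hypothesis phiD : forall x, 0 < phi x -> is_diff x phi (inner (p x)).
Hypothesis phi_out : forall x, D < `|x| -> phi x = 0.
Hypothesis phi0 : 0 < phi 0.
Hypothesis a_gt0 : forall x, 0 < phi x -> 0 < a x.

Let S y := [set v : R | 0 < v /\ v * phi (v^-1 *: y) <= 1].

Lemma dual_setE y :
  [set v : R | 0 < v /\ (Gamma @` epi f) (y, v)] = S y.
Proof.
apply/seteqP; split=> v [v0]; rewrite /S /=.
  move=> [[x u] [/= u0]]; rewrite lee_fin => xu [xy uv].
  have uV : u = v^-1.
    by apply: (@mulIf _ v); rewrite ?mulVf ?gt_eqF // -uv mulfV // gt_eqF.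
  rewrite -xy uv scalerA mulVf ?gt_eqF // scale1r.
  by rewrite -(mulfV (lt0r_neq0 v0)) -uV ler_pM2l.
move=> vy; split => //; exists (v^-1 *: y, v^-1) => /=.
  split; rewrite /= ?invr_gt0 // lee_fin.
  by rewrite -(ler_pM2l v0) divff // gt_eqF.
by rewrite /Gamma /= invrK scalerA divff ?gt_eqF // scale1r.
Qed.

Lemma dual_set_has_sup y : has_sup (S y).
Proof.
split.
  have [->|y0] := eqVneq y 0.
    exists (phi 0)^-1; split; first by rewrite invr_gt0.
    by rewrite scaler0 mulVf // gt_eqF.
  have ny : 0 < `|y| by rewrite normr_gt0.
  have D0 : 0 < `|D| + 1 by rewrite ltr_wpDl.
  exists (`|y| / (`|D| + 1)); split; first by rewrite divr_gt0.
  rewrite phi_out ?mulr0 // normrZ gtr0_norm ?invr_gt0 ?divr_gt0 //.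
  rewrite invf_div mulrAC -mulrA divff ?gt_eqF // mulr1.
  by rewrite (le_lt_trans (ler_norm D)) // ltrDl.
have h2 : phi 0 / 2 < phi 0 by rewrite ltr_pdivrMr // mulr_natr mulr2n ltrDl.
have : \forall x \near (0 : E), phi 0 / 2 < phi x by exact: (cvgr_gt _ (@phiC 0)).
move=> /nbhs_ballP[d /= d0 dP].
exists (Num.max ((`|y| + 1) / d) (2 / phi 0)) => v [v0 vy].
rewrite leNgt gt_max; apply/negP => /andP[v1 v2].
have : phi 0 / 2 < phi (v^-1 *: y).
  apply: dP; rewrite -ball_normE /= sub0r normrN normrZ gtr0_norm ?invr_gt0 //.
  rewrite mulrC ltr_pdivrMr //; move: v1; rewrite ltr_pdivrMr //.
  by move=> /(lt_trans _); rewrite mulrC; apply; rewrite ltrDl.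
rewrite -(ltr_pM2l v0) => /lt_le_trans/(_ vy).
by move: v2; rewrite ltr_pdivrMr //; lra.
Qed.

Definition dual_val y := sup (S y).

Lemma dual_set_le y v : S y v -> v <= dual_val y.
Proof. by move=> Sv; apply: ub_le_sup => //; have [] := dual_set_has_sup y. Qed.

Lemma dual_val_gt0 y : 0 < dual_val y.
Proof.
by have [[v Sv] _] := dual_set_has_sup y; have [/lt_le_trans + _] := Sv;
  apply; exact: dual_set_le.
Qed.

Lemma radial_dualE : radial_dual f = fun y => (dual_val y)%:E.
Proof.
apply/funext => y; rewrite /radial_dual dual_setE.
have [ne ub] := dual_set_has_sup y.
rewrite ereal_sup_EFin // -/(dual_val y) -EFin_max; congr EFin.
by apply/max_idPr; rewrite ltW // dual_val_gt0.
Qed.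

Lemma persp_le1 y v : 0 < v -> v * phi (v^-1 *: y) <= 1 -> v <= dual_val y.
Proof. by move=> v0 vy; apply: dual_set_le. Qed.

Lemma persp_gt1 y v : 0 < v -> 1 < v * phi (v^-1 *: y) -> dual_val y <= v.
Proof.
move=> v0 vy; apply: ge_sup; first by have [] := dual_set_has_sup y.
move=> w [w0 wy]; rewrite leNgt; apply/negP => /ltW vw.
by have := lt_le_trans vy (le_trans (phi_radial _ v0 vw) wy); rewrite ltxx.
Qed.

Lemma persp_dual_val y : dual_val y * phi ((dual_val y)^-1 *: y) = 1.
Proof.
have V0 := dual_val_gt0 y; set V := dual_val y in V0 *.
have cvgP : v * phi (v^-1 *: y) @[v --> V] --> V * phi (V^-1 *: y).
  apply: cvgM; first exact: cvg_id.
  apply: (cvg_comp (fun v => v^-1 *: y)); last exact: phiC.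
  apply: cvgZr_tmp; apply: cvgV; [by rewrite gt_eqF|exact: cvg_id].
apply/eqP; rewrite eq_le; apply/andP; split; rewrite leNgt; apply/negP => h.
  have : \forall v \near V, 1 < v * phi (v^-1 *: y) by exact: (cvgr_gt _ cvgP).
  move=> /nbhs_ballP[d /= d0 dP].
  pose v := Num.max (V - d / 2) (V / 2).
  have v0 : 0 < v by rewrite lt_max; apply/orP; right; lra.
  have vV : v < V by rewrite gt_max; apply/andP; split; lra.
  have /(persp_gt1 v0) : 1 < v * phi (v^-1 *: y).
    apply: dP; rewrite /ball /= ger0_norm ?subr_ge0 ?(ltW vV) // ltrBlDl -ltrBlDr.
    by rewrite lt_max; apply/orP; left; lra.
  by rewrite leNgt vV.
have : \forall v \near V, v * phi (v^-1 *: y) < 1 by exact: (cvgr_lt _ cvgP).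
move=> /nbhs_ballP[d /= d0 dP].
have v0 : 0 < V + d / 2 by rewrite addr_gt0 // divr_gt0.
have : V + d / 2 <= V.
  apply: persp_le1 => //; apply/ltW/dP.
  by rewrite /ball /= opprD addNKr normrN gtr0_norm ?divr_gt0 //; lra.
by rewrite gerDl leNgt divr_gt0.
Qed.

Definition base_pt y := (dual_val y)^-1 *: y.

Lemma phi_base_pt y : phi (base_pt y) = (dual_val y)^-1.
Proof.
have V0 := dual_val_gt0 y.
have /(congr1 (fun t => (dual_val y)^-1 * t)) := persp_dual_val y.
by rewrite mulr1 mulKf // gt_eqF.
Qed.

Lemma phi_base_pt_gt0 y : 0 < phi (base_pt y).
Proof. by rewrite phi_base_pt invr_gt0 dual_val_gt0. Qed.

Definition dual_slope x := (a x)^-1 *: p x.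

(* [v phi (z / v)] is affine in [(z, v)] at [(y, dual_val y)] up to first order,
   with coefficient [a] in [v]. *)
Lemma persp_expansion y z v e : 0 < v ->
  `|phi (v^-1 *: z) - phi (base_pt y) - inner (p (base_pt y)) (v^-1 *: z - base_pt y)|
    <= e * `|v^-1 *: z - base_pt y| ->
  `|v * phi (v^-1 *: z) - 1
    - ((v - dual_val y) * a (base_pt y) + inner (p (base_pt y)) (z - y))|
    <= e * `|z - y - (v - dual_val y) *: base_pt y|.
Proof.
move=> v0 h; have V0 := dual_val_gt0 y.
have vz : v *: (v^-1 *: z) = z by rewrite scalerA divff ?scale1r // gt_eqF.
have Vy : dual_val y *: base_pt y = y by rewrite scalerA divff ?scale1r // gt_eqF.
have -> : z - y - (v - dual_val y) *: base_pt y = v *: (v^-1 *: z - base_pt y).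
  by rewrite scalerBl Vy opprB addrA subrK scalerBr vz.
rewrite normrZ gtr0_norm // mulrCA.
rewrite -(ler_pM2l v0) in h; apply: le_trans h.
have -> : v * phi (v^-1 *: z) - 1
    - ((v - dual_val y) * a (base_pt y) + inner (p (base_pt y)) (z - y)) =
  v * (phi (v^-1 *: z) - phi (base_pt y)
    - inner (p (base_pt y)) (v^-1 *: z - base_pt y)).
  have -> : inner (p (base_pt y)) (z - y) = v * inner (p (base_pt y)) (v^-1 *: z)
      - dual_val y * inner (p (base_pt y)) (base_pt y).
    by rewrite -!innerZr vz Vy innerBr.
  by rewrite innerBr /a phi_base_pt; field; rewrite gt_eqF.
by rewrite normrM gtr0_norm.
Qed.

Lemma is_diff_dual_val y : is_diff y dual_val (inner (- dual_slope (base_pt y))).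
Proof.
apply/is_diff_innerP => e e0.
set x := base_pt y; set g := - dual_slope x; set V := dual_val y.
have V0 : 0 < V := dual_val_gt0 y.
have ax : 0 < a x := a_gt0 (phi_base_pt_gt0 y).
pose C := 1 + (`|g| + e) * `|x|.
have C0 : 0 < C by rewrite ltr_pwDl // mulr_ge0 // addr_ge0 // ltW.
pose eta := a x * e / (2 * C).
have eta0 : 0 < eta by rewrite divr_gt0 ?mulr_gt0.
have /is_diff_innerP/(_ eta eta0) exp := phiD (phi_base_pt_gt0 y).
pose v s z := V + (inner g (z - y) + s * `|z - y|).
have vC s : v s z @[z --> y] --> V.
  have -> : V = V + (inner g (y - y) + s * `|y - y|).
    by rewrite subrr inner0r normr0 mulr0 !addr0.
  have sC : z - y @[z --> y] --> y - y by apply: cvgB; [exact: cvg_id|exact: cvg_cst].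
  apply: cvgD; first exact: cvg_cst.
  apply: cvgD; first by apply: (cvg_comp _ _ sC); exact: continuous_inner.
  by apply: cvgMr; apply: cvg_norm.
have uC s : (v s z)^-1 *: z @[z --> y] --> x.
  apply: cvgZ; last exact: cvg_id.
  by apply: cvgV; [rewrite gt_eqF|exact: vC].
(* Along [v s], the expansion of [v phi (z / v)] reduces to [1 + a x s |z - y|]:
   for [s = e] and [s = - e] this traps [dual_val z] between [v (- e)] and [v e]. *)
have main s : `|s| <= e -> \forall z \near y, 0 < v s z /\
    `|v s z * phi ((v s z)^-1 *: z) - 1 - a x * s * `|z - y| |
      <= a x * e / 2 * `|z - y|.
  move=> se.
  have v_gt0 : \forall z \near y, 0 < v s z by exact: (cvgr_gt _ (vC s)).
  have := uC s _ exp; apply: filterS2 v_gt0 => z vz hz; split => //.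
  have := persp_expansion vz hz; rewrite -/x -/V.
  have -> : v s z - V = inner g (z - y) + s * `|z - y|.
    by rewrite /v addrC addKr.
  have -> : (inner g (z - y) + s * `|z - y|) * a x + inner (p x) (z - y) =
      a x * s * `|z - y|.
    by rewrite /g /dual_slope innerNl innerZl; field; rewrite gt_eqF.
  move=> /le_trans; apply.
  have -> : a x * e / 2 * `|z - y| = eta * (C * `|z - y|).
    by rewrite /eta; field; rewrite gt_eqF.
  rewrite ler_pM2l //; apply: le_trans (ler_normB _ _) _.
  rewrite /C mulrDl mul1r lerD2l normrZ mulrAC ler_wpM2r //.
  apply: le_trans (ler_normD _ _) _; rewrite mulrDl lerD ?cauchy_schwarz //.
  by rewrite normrM normr_id ler_wpM2r.
have e1 : `|e| <= e by rewrite gtr0_norm.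
have e2 : `|- e| <= e by rewrite normrN gtr0_norm.
apply: filterS2 (main _ e1) (main _ e2) => z [v1 h1] [v2 h2].
have [->|zy] := eqVneq z y; first by rewrite !subrr inner0r subrr !normr0 mulr0.
have nz : 0 < `|z - y| by rewrite normr_gt0 subr_eq0.
have aez : 0 < a x * e * `|z - y| by rewrite !mulr_gt0.
have up : dual_val z <= v e z.
  by apply: persp_gt1 => //; move: h1; rewrite ler_norml => /andP[]; lra.
have down : v (- e) z <= dual_val z.
  by apply: persp_le1 => //; move: h2; rewrite ler_norml => /andP[]; lra.
move: up down; rewrite /v -/V ler_norml => up down.
by apply/andP; split; lra.
Qed.

Hypothesis pL : forall x y, 0 < phi x -> 0 < phi y ->
  `|p x - p y| <= L * `|x - y|.
Hypothesis L_ge0 : 0 <= L.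
Hypothesis r_gt0 : 0 < r.
Hypothesis r_bound : forall x, 0 < phi x -> r * `|p x| <= a x.
Hypothesis k_ge0 : 0 <= k.
Hypothesis k_bound : forall x, 0 < phi x -> `|x| * `|p x| <= k * a x.

Lemma dual_val_cvg y : dual_val z @[z --> y] --> dual_val y.
Proof. by have [/differentiable_continuous] := is_diff_dual_val y. Qed.

Lemma base_pt_cvg y : base_pt z @[z --> y] --> base_pt y.
Proof.
apply: cvgZ; last exact: cvg_id.
by apply: cvgV; [rewrite gt_eqF // dual_val_gt0|exact: dual_val_cvg].
Qed.

Lemma norm_dual_slope_le x : 0 < phi x -> `|dual_slope x| <= r^-1.
Proof.
move=> dx; have ax := a_gt0 dx.
rewrite normrZ gtr0_norm ?invr_gt0 // ler_pdivrMl //.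
by rewrite ler_pdivlMr // mulrC r_bound.
Qed.

Lemma norm_mul_dual_slope_le x : 0 < phi x -> `|x| * `|dual_slope x| <= k.
Proof.
move=> dx; have ax := a_gt0 dx.
rewrite normrZ gtr0_norm ?invr_gt0 // mulrCA ler_pdivrMl //.
by rewrite [leRHS]mulrC k_bound.
Qed.

Lemma dual_slope_diff_le x x' e : 0 < phi x -> 0 < phi x' -> 0 <= e ->
  `|phi x' - phi x - inner (p x) (x' - x)| <= e * `|x' - x| ->
  a x * `|dual_slope x' - dual_slope x|
    <= (L * (1 + k) + e / r) * `|x' - x|.
Proof.
move=> dx dx' e0 hx.
have ax := a_gt0 dx; have ax' := a_gt0 dx'.
pose w := inner (p x' - p x) x' - (phi x' - phi x - inner (p x) (x' - x)).
have main : a x *: (dual_slope x' - dual_slope x) = p x' - p x + w *: dual_slope x'.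
  have -> : w = a x - a x'.
    by rewrite /w /a innerBl innerBr; ring.
  have slopeK u : 0 < a u -> a u *: dual_slope u = p u.
    by move=> au; rewrite scalerA divff ?scale1r // gt_eqF.
  have -> : (a x - a x') *: dual_slope x' = a x *: dual_slope x' - a x' *: dual_slope x'.
    exact: scalerBl.
  rewrite scalerBr [RHS]addrC !slopeK //.
  by rewrite addrA subrK.
rewrite -[X in X * _](gtr0_norm ax) -normrZ main.
apply: le_trans (ler_normD _ _) _; rewrite normrZ.
have := pL dx' dx.
have q1 := norm_dual_slope_le dx'; have q2 := norm_mul_dual_slope_le dx'.
have -> : (L * (1 + k) + e / r) * `|x' - x| =
   L * `|x' - x| + (L * `|x' - x| * k + e * `|x' - x| * r^-1).
  by field; rewrite gt_eqF.
move=> hp; apply: lerD => //.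
have hw : `|w| <= L * `|x' - x| * `|x'| + e * `|x' - x|.
  apply: le_trans (ler_normB _ _) _; apply: lerD => //.
  by apply: le_trans (cauchy_schwarz _ _) _; rewrite ler_wpM2r.
apply: le_trans (ler_wpM2r (normr_ge0 _) hw) _.
rewrite mulrDl -[L * _ * _ * _]mulrA.
by apply: lerD; rewrite ler_wpM2l // mulr_ge0.
Qed.

Lemma base_pt_diff_le y z e :
  `|dual_val z - dual_val y + inner (dual_slope (base_pt y)) (z - y)| <= e * `|z - y| ->
  phi (base_pt z) <= phi (base_pt y) + e ->
  `|base_pt z - base_pt y|
    <= (phi (base_pt y) + e) * (1 + k + e * `|base_pt y|) * `|z - y|.
Proof.
move=> hV hphi; set x := base_pt y; set x' := base_pt z.
have V0 := dual_val_gt0 y; have W0 := dual_val_gt0 z.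
have wx : dual_val z *: (x' - x) = z - y - (dual_val z - dual_val y) *: x.
  rewrite scalerBr scalerBl !scalerA !divff ?gt_eqF // !scale1r.
  by rewrite opprB addrA subrK.
have hN : dual_val z * `|x' - x| <= (1 + k + e * `|x|) * `|z - y|.
  rewrite -[X in X * _ <= _](gtr0_norm W0) -normrZ wx.
  apply: le_trans (ler_normB _ _) _; rewrite normrZ.
  have : `|dual_val z - dual_val y| <= (`|dual_slope x| + e) * `|z - y|.
    rewrite -[_ - _](addrK (inner (dual_slope x) (z - y))).
    apply: le_trans (ler_normB _ _) _; rewrite addrC mulrDl lerD //.
    exact: cauchy_schwarz.
  move=> /(ler_wpM2r (normr_ge0 x)) h.
  have := ler_wpM2r (normr_ge0 (z - y)) (norm_mul_dual_slope_le (phi_base_pt_gt0 y)).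
  by move: h; rewrite -/x; lra.
have -> : `|x' - x| = phi x' * (dual_val z * `|x' - x|).
  by rewrite phi_base_pt mulKf // gt_eqF.
rewrite -mulrA; apply: ler_pM => //; first exact/ltW/phi_base_pt_gt0.
by rewrite mulr_ge0 // ltW.
Qed.

Lemma phi_le_intercept x : 0 < phi x -> phi x <= (1 + k) * a x.
Proof.
move=> dx; have := k_bound dx; have := inner_le (p x) x.
by rewrite [`|p x| * _]mulrC /a; lra.
Qed.

Lemma dual_slope_lipschitz y z :
  `|dual_slope (base_pt z) - dual_slope (base_pt y)| <= (1 + k) ^+ 3 * L * `|z - y|.
Proof.
apply: (@lipschitz_of_local _ _ _ (dual_slope \o base_pt)) => {y z} y e e0 /=.
set x := base_pt y; have dx : 0 < phi x := phi_base_pt_gt0 y.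
have ax := a_gt0 dx.
pose F (t : R) := (L * (1 + k) + t / r) *
   ((phi x + t) * (1 + k + t * `|x|)).
have FC : F t @[t --> 0] --> F 0.
  have c0 (u v : R) : u + t * v @[t --> 0] --> u + 0 * v.
    apply: cvgD; first exact: cvg_cst.
    by apply: cvgMl; exact: cvg_id.
  apply: cvgM; last first.
    by apply: cvgM (c0 _ _); apply: cvgD; [exact: cvg_cst|exact: cvg_id].
  exact: c0.
have F0 : F 0 < a x * ((1 + k) ^+ 3 * L + e).
  rewrite /F !(mul0r, mulr0, addr0).
  have := ler_wpM2l (mulr_ge0 L_ge0 (sqr_ge0 (1 + k))) (phi_le_intercept dx).
  have := mulr_gt0 ax e0.
  by move: (a x) (phi x) => A B; lra.
have : \forall t \near (0 : R), F t < a x * ((1 + k) ^+ 3 * L + e).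
  exact: (cvgr_lt _ FC).
move=> /nbhs_ballP[d /= d0 dP]; pose t := d / 2.
have t0 : 0 < t by rewrite divr_gt0.
have Ft : F t < a x * ((1 + k) ^+ 3 * L + e).
  by apply: dP; rewrite /ball /= sub0r normrN gtr0_norm // /t; lra.
have /is_diff_innerP/(_ t t0) H1 := is_diff_dual_val y.
have /is_diff_innerP/(_ t t0)/base_pt_cvg H3 := phiD dx.
have H4 : \forall z \near y, phi (base_pt z) < phi x + t.
  have phix : phi (base_pt z) @[z --> y] --> phi x.
    by apply: (cvg_comp _ _ (@base_pt_cvg y)); exact: phiC.
  by apply: (cvgr_lt _ phix); rewrite ltrDl.
near=> z.
have h1 : `|dual_val z - dual_val y - inner (- dual_slope (base_pt y)) (z - y)|
    <= t * `|z - y|.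
  by near: z.
have h3 : `|phi (base_pt z) - phi x - inner (p x) (base_pt z - x)|
    <= t * `|base_pt z - x|.
  by near: z; exact: H3.
have h4 : phi (base_pt z) < phi x + t by near: z.
rewrite innerNl opprK in h1.
have hS := dual_slope_diff_le dx (phi_base_pt_gt0 z) (ltW t0) h3.
have hN := base_pt_diff_le h1 (ltW h4); rewrite -/x in hN hS *.
rewrite -(ler_pM2l ax); apply: le_trans hS _.
have C0 : 0 <= L * (1 + k) + t / r.
  apply: addr_ge0; last by rewrite divr_ge0 ?(ltW t0) ?(ltW r_gt0).
  by rewrite mulr_ge0 // addr_ge0.
apply: le_trans (ler_wpM2l C0 hN) _.
rewrite mulrA -/(F t) [leRHS]mulrA.
exact: ler_wpM2r (ltW Ft).
Unshelve. all: by end_near. Qed.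

End Dual.

Section Cases.
Set Implicit Arguments.
Unset Strict Implicit.
Context {R : realType} {E : euclideanType R}.
Implicit Types (f : E -> \bar R) (phi : E -> R).

Lemma smooth_of_dom0 f K : continuous f -> (forall x, ~ dom f x) -> smooth K f.
Proof.
move=> fC ndom; split; last by move=> x x' /ndom.
by split => // x /ndom.
Qed.

Lemma dom0_cases f : (forall x, (0 <= f x)%E) -> continuous f ->
  (forall x, ~ dom f x) -> f = cst 0%E \/ f = cst +oo%E.
Proof.
move=> f0 fC ndom.
have [[x fx]|noo] := pselect (exists x, f x = +oo%E).
  right; apply/funext => y.
  apply: (finite_or_infty f0 fC _ (lexx 0) _ y fx) => z /ndom [].
left; apply/funext => y; apply/eqP; apply: contra_notT (ndom y) => fy.
rewrite /dom /= lt_neqAle eq_sym fy f0 /= lt_neqAle leey andbT.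
by apply/eqP => fyoo; apply: noo; exists y.
Qed.

Lemma radial_dual_infty : radial_dual (cst +oo%E : E -> \bar R) = cst 0%E.
Proof.
apply/funext => y; rewrite /radial_dual.
set A := [set v | _]; suff -> : A = set0.
  by rewrite image_set0 ereal_sup0; apply/max_idPl; rewrite leNye.
by apply/seteqP; split => // v [_ [[x u] [_ /=]]]; rewrite leye_eq.
Qed.

Lemma radial_dual_zero : radial_dual (cst 0%E : E -> \bar R) = cst +oo%E.
Proof.
apply/funext => y; rewrite /radial_dual.
set A := [set v | _]; rewrite (@hasNub_ereal_sup _ A) ?maxey //.
  have A0 v : 0 < v -> A v.
    move=> v0; split => //; exists (v^-1 *: y, v^-1).
      by split => /=; rewrite ?lee_fin ?invr_ge0 ?invr_gt0 // ltW.
    by rewrite /Gamma /= invrK scalerA divff ?scale1r // gt_eqF.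
  move=> [B ubB]; have /ubB : A (`|B| + 1) by apply: A0; rewrite ltr_wpDl.
  by apply/negP; rewrite -ltNge (le_lt_trans (ler_norm B)) // ltrDl.
exists 1; split => //; exists (y, 1); last by rewrite /Gamma /= invr1 scale1r.
by split; rewrite /= ?lee_fin ?ltr01 ?ler01.
Qed.

Lemma lipschitz_continuous_at (g : E -> E) (C : R) y : 0 <= C ->
  (forall z, `|g z - g y| <= C * `|z - y|) -> {for y, continuous g}.
Proof.
move=> C0 gC; apply/cvgrPdist_lt => e e0.
have C1 : 0 < C + 1 by rewrite ltr_wpDl.
near=> z; rewrite distrC; apply: le_lt_trans (gC z) _.
have : `|y - z| < e / (C + 1).
  have : ball y (e / (C + 1)) z by near: z; exact/nbhsx_ballx/divr_gt0.
  by rewrite -ball_normE.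
rewrite ltr_pdivlMr // distrC => h.
by apply: le_lt_trans h; rewrite mulrC ler_wpM2l // lerDl.
Unshelve. all: by end_near. Qed.

Lemma ereal_quotient_bound (D : R) (T : \bar R) : 0 <= D -> (0 < T)%E ->
  exists2 r : R, 0 < r /\ (r%:E <= T)%E & forall P A : R, 0 <= P -> 0 <= A ->
  (forall s, 0 < s -> (s%:E <= T)%E -> s * P <= A) ->
  D * P <= fine (D%:E / T)%E * A.
Proof.
move=> D0; case: T => [t| |] // T0.
  have t0 : 0 < t by rewrite -lte_fin.
  exists t => [//|P A P0 A0 /(_ t t0 (lexx _)) h].
  rewrite inver gt_eqF //= -mulrA ler_wpM2l // mulrC.
  by rewrite ler_pdivlMr // mulrC.
exists 1; first by rewrite leey.
move=> P A P0 A0 h; rewrite invey mule0 mul0r.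
suff -> : P = 0 by rewrite mulr0.
apply/eqP; apply/negPn/negP => Pn0.
have {}P0 : 0 < P by rewrite lt_neqAle eq_sym Pn0.
have := h ((A + 1) / P); rewrite divr_gt0 ?ltr_wpDl // leey => /(_ isT isT).
by rewrite divfK // gerDl ler10.
Qed.

Lemma dom_norm_le f x : (dom_radius f < +oo)%E -> dom f x ->
  exists2 D : R, dom_radius f = D%:E & forall z, dom f z -> `|z| <= D.
Proof.
move=> Df dx.
have le_D z : dom f z -> (`|z|%:E <= dom_radius f)%E.
  by move=> dz; apply: ereal_sup_ubound; exists z.
have Dfin : dom_radius f = (fine (dom_radius f))%:E.
  rewrite fineK // fin_numElt Df andbT.
  exact: lt_le_trans (ltNyr _) (le_D x dx).
by exists (fine (dom_radius f)) => // z /le_D; rewrite Dfin lee_fin.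
Qed.

Lemma smooth_sign f (L : R) x (y z : E) : continuous f -> smooth L f ->
  dom f x -> y != z -> 0 <= L.
Proof.
move=> fC [_ fL] dx yz.
have d0 : 0 < `|y - z| by rewrite normr_gt0 subr_eq0.
have : x + t *: (y - z) @[t --> (0 : R)] --> x.
  rewrite -[in X in _ --> X](addr0 x) -(scale0r (y - z)).
  by apply: (cvgD (f := cst x)); [exact: cvg_cst|exact: (cvgZr_tmp cvg_id)].
move=> /(_ _ (dom_nbhs fC dx)) /nbhs_ballP[d /= dd0 dP].
have t0 : 0 < d / 2 by rewrite divr_gt0.
have dt : dom f (x + (d / 2) *: (y - z)).
  by apply: dP; rewrite /ball /= sub0r normrN gtr0_norm //; lra.
have := le_trans (normr_ge0 _) (fL _ _ dt dx).
by rewrite addrAC subrr add0r normrZ pmulr_lge0 // mulr_gt0 // normr_gt0 gt_eqF.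
Qed.

End Cases.

Theorem corollary1 (R : realType) (E : euclideanType R) (f : E -> \bar R) (L : R) :
  (forall x : E, (0 <= f x)%E) ->
  upper_radial f ->
  cont_diff2 f ->
  (dom_radius f < +oo)%E ->
  (0 < tangent_dist f)%E ->
  smooth L f ->
  smooth ((1 + fine (dom_radius f / tangent_dist f)%E) ^+ 3 * L) (radial_dual f).
Proof.
move=> f_ge0 [_ f_radial] _ D_lty T_gt0 fS; have [[fC fD] fL] := fS.
have [[x0 dx0]|ndom] := pselect (exists x, dom f x); last first.
  have {}ndom x : ~ dom f x by move=> dx; apply: ndom; exists x.
  have [->|->] := dom0_cases f_ge0 fC ndom.
    rewrite radial_dual_zero; apply: smooth_of_dom0; first exact: cst_continuous.
    by move=> x; rewrite /dom /= ltxx andbF.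
  rewrite radial_dual_infty; apply: smooth_of_dom0; first exact: cst_continuous.
  by move=> x; rewrite /dom /= ltxx.
have [D DE domD] := dom_norm_le D_lty dx0.
have D0 : 0 <= D := le_trans (normr_ge0 _) (domD _ dx0).
have fL' x x' : dom f x -> dom f x' -> `|grad f x - grad f x'| <= `|L| * `|x - x'|.
  by move=> dx dx'; apply: le_trans (fL _ _ dx dx') _; rewrite ler_wpM2r // ler_norm.
pose M := `|grad f x0| + `|L| * (D + D).
have M0 : 0 <= M by rewrite !(addr_ge0, mulr_ge0).
have fM x : dom f x -> `|grad f x| <= M.
  move=> dx; rewrite -[grad f x](subrK (grad f x0)) /M [leRHS]addrC.
  apply: le_trans (ler_normD _ _) _; rewrite lerD2r.
  apply: le_trans (fL' _ _ dx dx0) _; rewrite ler_wpM2l //.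
  by apply: le_trans (ler_normB _ _) _; rewrite lerD ?domD.
have fD' x (dx : dom f x) := proj1 (fD x dx).
pose phi x := fine (f x); pose p := grad f.
have fEx x : f x = (phi x)%:E.
  rewrite /phi fineK // fin_numE.
  rewrite gt_eqF ?(lt_le_trans _ (f_ge0 x)) //=.
  apply/eqP => fx; have := finite_or_infty f_ge0 fC fD' M0 fM x0 fx.
  by move=> fx0; move: dx0; rewrite /dom /= fx0 ltxx andbF.
have fE : f = fun x => (phi x)%:E by apply/funext.
have phiC : continuous phi.
  by move=> x; apply: fine_cvg; rewrite -fEx; exact: fC.
have domE x : dom f x = (0 < phi x) :> Prop.
  by rewrite /dom /= fEx lte_fin ltry andbT.
have phi_radial y v w : 0 < v -> v <= w ->
    v * phi (v^-1 *: y) <= w * phi (w^-1 *: y).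
  by move=> v0 vw; have := f_radial y v w v0 vw; rewrite /persp !fEx -!EFinM lee_fin.
have phiD x : 0 < phi x -> is_diff x phi (inner (p x)).
  by rewrite -domE => dx; exact: is_diff_grad (fD' x dx).
have pL x y : 0 < phi x -> 0 < phi y -> `|p x - p y| <= `|L| * `|x - y|.
  by rewrite -!domE; exact: fL'.
have phi_out x : D < `|x| -> phi x = 0.
  move=> Dx; apply/eqP; rewrite eq_le fine_ge0 ?f_ge0 // andbT leNgt.
  by apply: contraTN Dx => dx; rewrite -leNgt domD ?domE.
have r_bound s : 0 < s -> (s%:E <= tangent_dist f)%E -> forall x, 0 < phi x ->
    s * `|p x| <= phi x - inner (p x) x.
  rewrite [in tangent_dist _]fE => s0 sT x dx.
  exact: (grad_le_intercept phiC phi_radial phiD pL sT dx).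
have [r [r0 rT] hk] := ereal_quotient_bound D0 T_gt0.
have rT' : (r%:E <= tangent_dist (fun x => (phi x)%:E))%E by rewrite -fE.
have phi_0 : 0 < phi 0.
  by apply: (phi0_gt0 phiC phi_radial phiD pL r0 rT' (x := x0)); rewrite -domE.
have a_gt0 x : 0 < phi x -> 0 < phi x - inner (p x) x.
  exact: (intercept_gt0 phiC phi_radial phiD pL r0 rT').
rewrite DE; set k := fine _ in hk *.
have k_bound x : 0 < phi x -> `|x| * `|p x| <= k * (phi x - inner (p x) x).
  move=> dx; have /hk : 0 <= `|p x| by [].
  move=> /(_ _ (ltW (a_gt0 x dx)) (fun s s0 sT => r_bound s s0 sT x dx)).
  by apply: le_trans; rewrite ler_wpM2r // domD ?domE.
have k0 : 0 <= k.
  by rewrite fine_ge0 // mule_ge0 ?lee_fin // inve_ge0 ltW.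
have dualE : radial_dual f = fun y => (dual_val phi y)%:E.
  rewrite fE; exact: radial_dualE phiC phi_out phi_0.
have dualD y := is_diff_dual_val phiC phi_radial phiD phi_out phi_0 a_gt0 y.
have dual_grad y : grad (radial_dual f) y = - dual_slope phi p (base_pt phi y).
  by apply: grad_unique; rewrite dualE; exact: dualD.
have slopeL y z := dual_slope_lipschitz phiC phi_radial phiD phi_out phi_0 a_gt0
  pL (normr_ge0 L) r0 (r_bound r r0 rT) k0 k_bound y z.
have K0 : 0 <= (1 + k) ^+ 3 * `|L| by rewrite mulr_ge0 // exprn_ge0 // addr_ge0.
have dualL y z : `|grad (radial_dual f) y - grad (radial_dual f) z| <=
    (1 + k) ^+ 3 * `|L| * `|y - z|.
  by rewrite !dual_grad opprK [X in `|X|]addrC [`|y - z|]distrC slopeL.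
split.
  split; first by rewrite dualE => y; apply: cvg_EFin;
    [exact: nearW|have [/differentiable_continuous] := dualD y].
  move=> y _; split; first by rewrite dualE; have [] := dualD y.
  exact: lipschitz_continuous_at K0 (fun z => dualL z y).
move=> y z _ _; have [->|yz] := eqVneq y z; first by rewrite !subrr !normr0 mulr0.
by have := dualL y z; rewrite (ger0_norm (smooth_sign fC fS dx0 yz)).
Qed.
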